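(* Let $X$ be a set. The operated group $(\mathcal{G}(X),P_X)$, together with the map $j_X:X\to\mathcal{G}(X)$ (all constructed in the context), is the free operated group on $X$. That is, for every operated group $(G,P)$ and every map $f:X\to G$, there is a unique homomorphism of operated groups $\overline{f}:(\mathcal{G}(X),P_X)\to(G,P)$ such that $\overline{f}\, j_X=f$.
   Context: An operated group is a pair $(G,P)$ consisting of a group $G$ and a map of sets $P:G\to G$ (no condition on $P$). A homomorphism of operated groups $(G,P)\to(G',P')$ is a group homomorphism $f:G\to G'$ with $P'f=fP$. For a set $Y$, let $F(Y)$ be the free group on $Y$ (reduced words in $Y\sqcup Y^{-1}$), and let $\lfloor Y\rfloor=\{\lfloor y\rfloor \mid y\in Y\}$ denote a set in bijection with $Y$ but disjoint from $Y$. Construction. Given a set $X$, define groups $\mathcal{G}_n=\mathcal{G}_n(X)$ recursively by $\mathcal{G}_0:=F(X)$ and $\mathcal{G}_{n+1}:=F(X\sqcup\lfloor\mathcal{G}_n\rfloor)$ for $n\ge 0$. Define injective group homomorphisms $i_{n,n+1}:\mathcal{G}_n\to\mathcal{G}_{n+1}$ recursively: $i_{0,1}$ is induced by the inclusion $X\to X\sqcup\lfloor F(X)\rfloor$; and for $n\ge1$, $i_{n,n+1}:F(X\sqcup\lfloor\mathcal{G}_{n-1}\rfloor)\to F(X\sqcup\lfloor\mathcal{G}_n\rfloor)$ is induced by the identity on $X$ and $\lfloor w\rfloor\mapsto\lfloor i_{n-1,n}(w)\rfloor$ for $w\in\mathcal{G}_{n-1}$. Let $\mathcal{G}(X):=\varinjlim\mathcal{G}_n=\bigcup_{n\ge0}\mathcal{G}_n$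 be the direct limit group, in which each $\mathcal{G}_n$ is regarded as a subgroup. Define $P_X:\mathcal{G}(X)\to\mathcal{G}(X)$ as follows: for $u\in\mathcal{G}(X)$ choose $n$ with $u\in\mathcal{G}_n$ and put $P_X(u):=\lfloor u\rfloor\in\mathcal{G}_{n+1}\subseteq\mathcal{G}(X)$ (this is independent of $n$). Let $j_X:X\to\mathcal{G}(X)$ be the natural inclusion. *)

(* Defs.v *)
From HB Require Import structures.
From mathcomp Require Import all_boot.
From mathcomp Require Import boolp.

Set Implicit Arguments.
Unset Strict Implicit.
Unset Printing Implicit Defensive.

Local Open Scope group_scope.

(* P : G -> G is an arbitrary map of sets: the mixin carries no axiom. *)
HB.mixin Record isOperated G of Group G := { operator : G -> G }.

#[short(type="operatedGroupType")]
HB.structure Definition OperatedGroup := {G of isOperated G & Group G}.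

Definition operated_morphism (G H : operatedGroupType) (f : G -> H) : Prop :=
  {morph f : x y / x * y} /\ (forall x, operator (f x) = f (operator x)).

Section FreeGroup.
Variable Y : Type.

(* The letter (y, false) stands for y and (y, true) for y^-1; {classic Y} is Y
   with its classical decidable equality. *)
Definition letter : choiceType := ({classic Y} * bool)%type.

Definition letter_inv (l : letter) : letter := (l.1, ~~ l.2).

Definition reduced (s : seq letter) : bool :=
  sorted (fun l m => m != letter_inv l) s.

(* Left multiplication of a reduced word by a letter. *)
Definition reduced_cons (l : letter) (s : seq letter) : seq letter :=
  if s is m :: s' then if m == letter_inv l then s' else l :: s else [:: l].

Definition word_mul (s t : seq letter) : seq letter := foldr reduced_cons t s.

Definition word_inv (s : seq letter) : seq letter := rev (map letter_inv s).

Lemma letter_invK : involutive letter_inv.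
Proof. by case=> y b; rewrite /letter_inv /= negbK. Qed.

Lemma reduced_behead l s : reduced (l :: s) -> reduced s.
Proof. exact: path_sorted. Qed.

Lemma reduced_reduced_cons l s : reduced s -> reduced (reduced_cons l s).
Proof.
case: s => [|m s] // rs; rewrite /reduced_cons; case: ifP => [_|ml].
  exact: reduced_behead rs.
by rewrite /reduced /= ml.
Qed.

Lemma reduced_word_mul s t : reduced t -> reduced (word_mul s t).
Proof.
by move=> rt; elim: s => [|l s IHs] //=; apply: reduced_reduced_cons.
Qed.

Lemma reduced_consE l s : reduced (l :: s) -> reduced_cons l s = l :: s.
Proof. by case: s => [|m s] // /andP[/negPf ml _]; rewrite /= ml. Qed.

Lemma reduced_consK l s : reduced s ->
  reduced_cons l (reduced_cons (letter_inv l) s) = s.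
Proof.
case: s => [|m s] rs; first by rewrite /= eqxx.
rewrite {2}/reduced_cons letter_invK; case: eqP => [ml|_].
  by rewrite -ml; apply: reduced_consE.
by rewrite /= eqxx.
Qed.

Lemma word_mul_cons l s u : reduced u ->
  word_mul (reduced_cons l s) u = reduced_cons l (word_mul s u).
Proof.
case: s => [|m s] // ru; rewrite {1}/reduced_cons; case: eqP => [->|//].
by rewrite /= reduced_consK //; apply: reduced_word_mul.
Qed.

Lemma word_mulA s t u : reduced u ->
  word_mul s (word_mul t u) = word_mul (word_mul s t) u.
Proof. by move=> ru; elim: s => //= l s ->; rewrite word_mul_cons. Qed.

Lemma word_muls0 s : reduced s -> word_mul s [::] = s.
Proof.
elim: s => //= l s IHs rls.
by rewrite IHs ?reduced_consE //; apply: reduced_behead rls.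
Qed.

Lemma word_mulV s : reduced s -> word_mul (word_inv s) s = [::].
Proof.
elim: s => // l s IHs rls; rewrite /word_inv /= rev_cons /word_mul foldr_rcons.
by rewrite /= letter_invK eqxx; apply: IHs; apply: reduced_behead rls.
Qed.

Lemma word_invK : involutive word_inv.
Proof.
by move=> s; rewrite /word_inv map_rev revK -map_comp map_id_in // => l _;
   apply: letter_invK.
Qed.

Lemma reduced_word_inv s : reduced s -> reduced (word_inv s).
Proof.
rewrite /reduced /word_inv rev_sorted sorted_map; apply: sub_sorted => l m /=.
by rewrite letter_invK eq_sym.
Qed.

Lemma word_mulsV s : reduced s -> word_mul s (word_inv s) = [::].
Proof.
by move=> rs; rewrite -{1}(word_invK s) word_mulV //; apply: reduced_word_inv.
Qed.

Definition freeGroup : Type := {s : seq letter | reduced s}.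

HB.instance Definition _ := Choice.on freeGroup.

Definition freeGroup_one : freeGroup := exist _ [::] isT.
Definition freeGroup_mul (u v : freeGroup) : freeGroup :=
  exist _ (word_mul (val u) (val v)) (reduced_word_mul (val u) (valP v)).
Definition freeGroup_inv (u : freeGroup) : freeGroup :=
  exist _ (word_inv (val u)) (reduced_word_inv (valP u)).

Lemma freeGroup_mulA : associative freeGroup_mul.
Proof. by move=> u v w; apply/val_inj/word_mulA/valP. Qed.
Lemma freeGroup_mul1 : left_id freeGroup_one freeGroup_mul.
Proof. by move=> u; apply/val_inj. Qed.
Lemma freeGroup_mul1r : right_id freeGroup_one freeGroup_mul.
Proof. by move=> u; apply/val_inj/word_muls0/valP. Qed.
Lemma freeGroup_mulV : left_inverse freeGroup_one freeGroup_inv freeGroup_mul.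
Proof. by move=> u; apply/val_inj/word_mulV/valP. Qed.
Lemma freeGroup_mulVr : right_inverse freeGroup_one freeGroup_inv freeGroup_mul.
Proof. by move=> u; apply/val_inj/word_mulsV/valP. Qed.

HB.instance Definition _ := isGroup.Build freeGroup
  freeGroup_mulA freeGroup_mul1 freeGroup_mul1r freeGroup_mulV freeGroup_mulVr.

Definition freeGroup_gen (y : Y) : freeGroup :=
  exist _ [:: ((y : {classic Y}), false)] isT.

Section Induced.
Variables (G : groupType) (f : Y -> G).

Definition letter_eval (l : letter) : G :=
  if l.2 then (f l.1)^-1 else f l.1.

(* The homomorphism F(Y) -> G induced by f : Y -> G. *)
Definition freeGroup_lift (u : freeGroup) : G :=
  \prod_(l <- val u) letter_eval l.

Lemma letter_evalV l : letter_eval (letter_inv l) = (letter_eval l)^-1.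
Proof. by case: l => y [] //=; rewrite /letter_eval /= invgK. Qed.

Lemma freeGroup_liftM : {morph freeGroup_lift : u v / u * v}.
Proof.
move=> u v; rewrite /freeGroup_lift /=.
elim: (val u) => [|l s IHs]; first by rewrite big_nil mul1g.
rewrite big_cons -mulgA -IHs /=; case: (word_mul s _) => [|m t] /=.
  by rewrite big_seq1 big_nil mulg1.
by case: eqP => [->|_]; rewrite !big_cons // letter_evalV mulVKg.
Qed.

Lemma freeGroup_lift1 : freeGroup_lift 1 = 1.
Proof. exact: big_nil. Qed.

HB.instance Definition _ := isUMagmaMorphism.Build freeGroup G freeGroup_lift
  (freeGroup_lift1, freeGroup_liftM).

Lemma freeGroup_lift_gen y : freeGroup_lift (freeGroup_gen y) = f y.
Proof. by rewrite /freeGroup_lift /= big_seq1. Qed.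

End Induced.
End FreeGroup.

Section DirectLimit.
Variables (G : nat -> groupType) (i : forall n, UMagmaMorphism.type (G n) (G n.+1)).

Definition next_stage (u : {n & G n}) : {n & G n} :=
  Tagged G (i _ (tagged u)).

(* The image of u in G N when tag u <= N (and 1 otherwise); tagged_as is the
   cast along N - tag u + tag u = N. *)
Definition at_stage (N : nat) (u : {n & G n}) : G N :=
  tagged_as (Tagged G (1 : G N)) (iter (N - tag u) next_stage u).

Definition same_limit (u v : {n & G n}) : bool :=
  `[< exists N, [/\ (tag u <= N)%N, (tag v <= N)%N &
                    at_stage N u = at_stage N v] >].

Lemma tag_iter k u : tag (iter k next_stage u) = (k + tag u)%N.
Proof. by elim: k => //= k ->. Qed.

Lemma at_stageE N u : (tag u <= N)%N ->
  Tagged G (at_stage N u) = iter (N - tag u) next_stage u.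
Proof.
move=> le_uN; rewrite /at_stage.
have: tag (iter (N - tag u) next_stage u) = N by rewrite tag_iter subnK.
by case: (iter _ _ _) => n a /= eq_nN; case: N / eq_nN {le_uN}; rewrite tagged_asE.
Qed.

Lemma Tagged_inj n : injective (@Tagged nat n G : G n -> {n & G n}).
Proof.
move=> a b eq_ab.
pose cast u := tagged_as (Tagged G (1 : G n)) u.
by have /= := congr1 cast eq_ab; rewrite /cast !tagged_asE.
Qed.

Lemma at_stage_id n (a : G n) : at_stage n (Tagged G a) = a.
Proof. by apply: Tagged_inj; rewrite at_stageE //= subnn. Qed.

Lemma at_stageS N u : (tag u <= N)%N -> at_stage N.+1 u = i N (at_stage N u).
Proof.
move=> le_uN; apply: Tagged_inj; rewrite at_stageE ?(leqW le_uN) // subSn //=.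
by rewrite -at_stageE.
Qed.

Lemma at_stage_next N u :
  (tag u < N)%N -> at_stage N (next_stage u) = at_stage N u.
Proof.
move=> lt_uN; apply: Tagged_inj; rewrite !at_stageE //= ?(ltnW lt_uN) //.
by rewrite -iterSr -subSn.
Qed.

Lemma at_stage_eq N M u v : (tag u <= N)%N -> (tag v <= N)%N -> (N <= M)%N ->
  at_stage N u = at_stage N v -> at_stage M u = at_stage M v.
Proof.
move=> le_uN le_vN /subnK <-; elim: (M - N)%N => // k IHk /IHk.
by rewrite addSn !at_stageS ?(leq_trans _ (leq_addl _ _)) // => ->.
Qed.

Lemma same_limit_equiv : equiv_class_of same_limit.
Proof.
split=> [u|u v|v u w].
- by apply/asboolP; exists (tag u).
- by apply/asbool_equiv_eq; split=> -[N [? ? ?]]; exists N.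
move=> /asboolP[N [uN vN euv]] /asboolP[M [vM wM evw]].
apply/asboolP; exists (maxn N M).
have [N_le M_le] := (leq_maxl N M, leq_maxr N M).
split; [exact: leq_trans uN _ | exact: leq_trans wM _ |].
by rewrite (at_stage_eq uN vN N_le euv) (at_stage_eq vM wM M_le evw).
Qed.

Canonical same_limit_rel := EquivRelPack same_limit_equiv.

Local Open Scope quotient_scope.

Definition directLimit : Type := {eq_quot same_limit_rel}.

HB.instance Definition _ := Choice.on directLimit.
HB.instance Definition _ := Quotient.on directLimit.

Definition of_stage (n : nat) (a : G n) : directLimit :=
  \pi_directLimit (Tagged G a).

Definition limit_one : directLimit := of_stage (1 : G 0).

Definition limit_mul (x y : directLimit) : directLimit :=
  let N := maxn (tag (repr x)) (tag (repr y)) in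
  of_stage (at_stage N (repr x) * at_stage N (repr y)).

Definition limit_inv (x : directLimit) : directLimit :=
  of_stage (tagged (repr x))^-1.

Lemma of_stageP n (a : G n) m (b : G m) :
  of_stage a = of_stage b <-> exists N, [/\ (n <= N)%N, (m <= N)%N &
    at_stage N (Tagged G a) = at_stage N (Tagged G b)].
Proof. by split=> [/eqmodP/asboolP | ?] //; apply/eqmodP/asboolP. Qed.

Lemma of_stage_next n (a : G n) : of_stage (i n a) = of_stage a.
Proof.
apply/of_stageP; exists n.+1; split=> //.
by rewrite -(at_stage_next (ltnSn _ : (tag (Tagged G a) < _)%N)).
Qed.

Lemma of_at_stage N u : (tag u <= N)%N -> of_stage (at_stage N u) = \pi u.
Proof.
move=> /subnK <-; elim: (N - _)%N => [|k IHk].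
  by case: u => n a; rewrite at_stage_id.
by rewrite addSn at_stageS ?leq_addl // of_stage_next IHk.
Qed.

Lemma of_stage_at n (a : G n) N :
  (n <= N)%N -> of_stage (at_stage N (Tagged G a)) = of_stage a.
Proof. exact: (@of_at_stage N (Tagged G a)). Qed.

Lemma of_stageE x : of_stage (tagged (repr x)) = x.
Proof. by rewrite -[RHS]reprK /of_stage; case: (repr x). Qed.

Lemma at_stageM N n (a b : G n) : (n <= N)%N ->
  at_stage N (Tagged G (a * b)) =
  at_stage N (Tagged G a) * at_stage N (Tagged G b).
Proof.
move=> /subnK <-; elim: (N - n)%N => [|k IHk]; first by rewrite !at_stage_id.
by rewrite addSn !at_stageS ?leq_addl // IHk gmulfM.
Qed.

Lemma of_stageM n (a b : G n) :
  limit_mul (of_stage a) (of_stage b) = of_stage (a * b).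
Proof.
rewrite /limit_mul; set u := repr _; set v := repr (of_stage b); set N := maxn _ _.
have /of_stageP[p [/= up np eq_u]] : of_stage (tagged u) = of_stage a.
  exact: of_stageE.
have /of_stageP[q [/= vq nq eq_v]] : of_stage (tagged v) = of_stage b.
  exact: of_stageE.
pose M := maxn N (maxn p q).
have NM : (N <= M)%N := leq_maxl _ _.
have pM : (p <= M)%N by rewrite !leq_max leqnn orbT.
have qM : (q <= M)%N by rewrite !leq_max leqnn !orbT.
have nM := leq_trans np pM.
rewrite -(of_stage_at _ NM) at_stageM // -(of_stage_at _ nM) at_stageM //.
have atK w : (tag w <= N)%N ->
    at_stage M (Tagged G (at_stage N w)) = at_stage M (Tagged G (tagged w)).
  move=> wN; apply: (@at_stage_eq N) => //; rewrite at_stage_id.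
  by case: w wN.
rewrite !atK ?leq_maxl ?leq_maxr //.
by rewrite (at_stage_eq _ _ pM eq_u) // (at_stage_eq _ _ qM eq_v).
Qed.

Lemma limit_common (x y z : directLimit) : exists n (a b c : G n),
  [/\ x = of_stage a, y = of_stage b & z = of_stage c].
Proof.
pose t w := tag (repr (w : directLimit)).
pose N := maxn (t x) (maxn (t y) (t z)).
exists N, (at_stage N (repr x)), (at_stage N (repr y)), (at_stage N (repr z)).
by split; rewrite of_at_stage ?reprK // /N !leq_max leqnn ?orbT.
Qed.

Lemma of_stage1 n : of_stage (1 : G n) = limit_one.
Proof. by elim: n => // n <-; rewrite -(gmulf1 (s := i n)) of_stage_next. Qed.

Lemma limit_mulA : associative limit_mul.
Proof.
move=> x y z; have [n [a [b [c [-> -> ->]]]]] := limit_common x y z.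
by rewrite !of_stageM mulgA.
Qed.

Lemma limit_mul1 : left_id limit_one limit_mul.
Proof. by move=> x; rewrite -(of_stageE x) -(of_stage1 (tag (repr x))) of_stageM mul1g. Qed.

Lemma limit_mul1r : right_id limit_one limit_mul.
Proof. by move=> x; rewrite -(of_stageE x) -(of_stage1 (tag (repr x))) of_stageM mulg1. Qed.

Lemma limit_mulV : left_inverse limit_one limit_inv limit_mul.
Proof.
by move=> x; rewrite -[x in limit_mul _ x]of_stageE of_stageM mulVg of_stage1.
Qed.

Lemma limit_mulVr : right_inverse limit_one limit_inv limit_mul.
Proof.
by move=> x; rewrite -[x in limit_mul x _]of_stageE of_stageM mulgV of_stage1.
Qed.

HB.instance Definition _ := isGroup.Build directLimit
  limit_mulA limit_mul1 limit_mul1r limit_mulV limit_mulVr.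

End DirectLimit.

Section FreeOperatedGroup.
Variable X : Type.

(* X + tower n is the disjoint union of X and the bracketed elements of
   tower n: inr w stands for the bracket of w. *)
Fixpoint tower (n : nat) : groupType :=
  if n is n'.+1 then freeGroup (X + tower n') else freeGroup X.

Definition bracket (n : nat) (w : tower n) : tower n.+1 :=
  freeGroup_gen (inr w).

Definition bracket_map (A B : Type) (h : A -> B) (z : X + A) : X + B :=
  match z with inl x => inl x | inr w => inr (h w) end.

Fixpoint tower_incl (n : nat) : UMagmaMorphism.type (tower n) (tower n.+1) :=
  match n return UMagmaMorphism.type (tower n) (tower n.+1) with
  | 0 => freeGroup_lift (fun x => freeGroup_gen (inl x) : tower 1)
  | n'.+1 => freeGroup_lift
      (fun z => freeGroup_gen (bracket_map (tower_incl n') z) : tower n'.+2)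
  end.

Definition freeOperatedGroup : Type := directLimit tower_incl.

HB.instance Definition _ := Group.on freeOperatedGroup.

Definition free_operator (u : freeOperatedGroup) : freeOperatedGroup :=
  of_stage tower_incl (bracket (tagged (repr u))).

HB.instance Definition _ := isOperated.Build freeOperatedGroup free_operator.

Definition free_operated_gen (x : X) : freeOperatedGroup :=
  of_stage tower_incl (freeGroup_gen x : tower 0).

Lemma free_operatorE n (w : tower n) :
  free_operator (of_stage tower_incl w) = of_stage tower_incl (bracket w).
Proof.
rewrite /free_operator; set u := repr _.
have /of_stageP[N [/= uN nN eq_uw]] :
    of_stage tower_incl (tagged u) = of_stage tower_incl w by exact: of_stageE.
suff brE v : (tag v <= N)%N -> of_stage tower_incl (bracket (tagged v)) =
    of_stage tower_incl (bracket (at_stage tower_incl N v)).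
  rewrite brE // (brE (Tagged tower w)) // -eq_uw.
  by congr (of_stage _ (bracket (at_stage _ _ _))); case: (u).
move=> /subnK <-; elim: (N - _)%N => [|k IHk].
  by case: v => m a; rewrite at_stage_id.
rewrite IHk addSn at_stageS ?leq_addl // -[LHS]of_stage_next.
by rewrite /= freeGroup_lift_gen.
Qed.

End FreeOperatedGroup.

(* Main.v *)
Require Import Defs.
From HB Require Import structures.
From mathcomp Require Import all_boot.
From mathcomp Require Import boolp.

(** Both the free group and the direct limit are universal for the maps out of
    them, and the free operated group is an alternation of the two. On
    [tower 0 = F(X)] a morphism extending [f] has to be the homomorphism
    induced by [f]. On [tower n.+1] it has to send [x] to [f x] and the bracket
    of [w] to [operator] of its value at [w], a value already determined on
    [tower n]; by freeness of [tower n.+1] these values can be prescribed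
    arbitrarily, whatever the map [operator] is. So there is exactly one
    possible family [tower_eval f n : tower n -> G].

    It remains to see that the family glues. The inclusion of [tower n] sends
    the bracket of [w] to the bracket of the included [w], so compatibility at
    stage [n] gives compatibility on the generators of stage [n.+1], and
    therefore everywhere ([tower_eval_incl]). The glued map [operated_lift]
    commutes with the operators because brackets are evaluated by applying
    [operator], and it is unique because every element of the limit comes from
    some stage ([operated_lift_unique]). *)

Set Implicit Arguments.
Unset Strict Implicit.
Unset Printing Implicit Defensive.

Local Open Scope group_scope.

Section FreeGroupUniqueness.
Variables (Y : Type) (H : groupType).

(** Only multiplicativity is asked of [phi], since that is all a morphism of
    operated groups provides; [phi 1 = 1] and [phi u^-1 = (phi u)^-1] follow by
    cancellation in [H]. *)
Lemma freeGroup_lift_unique (h : Y -> H) (phi : freeGroup Y -> H) :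
  {morph phi : u v / u * v} -> (forall y, phi (freeGroup_gen y) = h y) ->
  phi =1 freeGroup_lift h.
Proof.
move=> phiM phi_gen.
have phi1 : phi 1 = 1 by apply: (mulgI (phi 1)); rewrite -phiM !mulg1.
have phiV u : phi u^-1 = (phi u)^-1.
  by apply: (mulgI (phi u)); rewrite -phiM !mulgV.
case=> s; elim: s => [|[y b] s IHs] rs.
  have -> : exist _ [::] rs = 1 :> freeGroup Y by apply: val_inj.
  by rewrite phi1 freeGroup_lift1.
pose g : freeGroup Y := if b then (freeGroup_gen y)^-1 else freeGroup_gen y.
(* A reduced word is the product of its first letter and of its tail, with no
   cancellation. *)
have -> : exist _ ((y, b) :: s) rs = g * exist _ s (reduced_behead rs)
    :> freeGroup Y.
  by apply: val_inj; rewrite /g; case: (b) rs => rs /=; rewrite reduced_consE.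
rewrite phiM freeGroup_liftM IHs; congr (_ * _); rewrite /g.
by case: (b); rewrite ?phiV ?gmulfV /= phi_gen freeGroup_lift_gen.
Qed.

End FreeGroupUniqueness.

Section DirectLimitLift.
Variables (G : nat -> groupType).
Variables (i : forall n, UMagmaMorphism.type (G n) (G n.+1)).
Variables (T : Type) (h : forall n, G n -> T).
Hypothesis h_incl : forall n (a : G n), h (i n a) = h a.

Definition limit_lift (x : directLimit i) : T := h (tagged (repr x)).

Lemma at_stage_compatible N u : (tag u <= N)%N ->
  h (at_stage i N u) = h (tagged u).
Proof.
move=> /subnK <-; elim: (N - _)%N => [|k IHk].
  by case: u => n a; rewrite at_stage_id.
by rewrite addSn at_stageS ?leq_addl // h_incl.
Qed.

(** The choice of representative made by [repr] does not matter: two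
    representatives of one element have equal images at some later stage, and
    [h] does not change along the stages. *)
Lemma limit_lift_of_stage n (a : G n) : limit_lift (of_stage i a) = h a.
Proof.
rewrite /limit_lift; set u := repr _.
have /of_stageP[N [/= uN nN eq_ua]] : of_stage i (tagged u) = of_stage i a.
  exact: of_stageE.
have := congr1 (@h N) eq_ua.
by rewrite !at_stage_compatible.
Qed.

End DirectLimitLift.

(** The limit identifies the copies of [x] in all the stages, so prescribing the
    value at [free_operated_gen x] prescribes it at every stage. *)
Lemma of_stage_gen (X : Type) n (x : X) :
  of_stage (tower_incl X) (freeGroup_gen (inl x) : tower X n.+1) =
  free_operated_gen x.
Proof.
by elim: n => [|n <-]; rewrite -[RHS]of_stage_next /= freeGroup_lift_gen.
Qed.

Section OperatedLift.
Variables (X : Type) (G : operatedGroupType) (f : X -> G).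

(** The value [operator (ev w)] of a bracket is forced by commutation with the
    operators. *)
Definition bracket_eval (A : Type) (ev : A -> G) (z : X + A) : G :=
  match z with inl x => f x | inr w => operator (ev w) end.

Fixpoint tower_eval (n : nat) : tower X n -> G :=
  match n return tower X n -> G with
  | 0 => freeGroup_lift f
  | n'.+1 => freeGroup_lift (bracket_eval (@tower_eval n'))
  end.

Lemma tower_evalM n : {morph @tower_eval n : u v / u * v}.
Proof. by case: n => [|n]; apply: freeGroup_liftM. Qed.

Lemma tower_eval_incl n (w : tower X n) :
  tower_eval (tower_incl X n w) = tower_eval w.
Proof.
elim: n w => [|n IHn].
  apply: (@freeGroup_lift_unique X G f
    (fun w : tower X 0 => tower_eval (tower_incl X 0 w))) => [u v|x].
    by rewrite gmulfM tower_evalM.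
  by rewrite /= !freeGroup_lift_gen.
apply: (@freeGroup_lift_unique _ G (bracket_eval (@tower_eval n))
  (fun w : tower X n.+1 => tower_eval (tower_incl X n.+1 w))) => [u v|z].
  by rewrite gmulfM tower_evalM.
(* On a bracket this is [operator] applied to compatibility one stage below. *)
rewrite /= !freeGroup_lift_gen; case: z => [x|w] //=.
by congr operator; apply: IHn.
Qed.

Definition operated_lift : freeOperatedGroup X -> G := limit_lift tower_eval.

Lemma operated_lift_of_stage n (w : tower X n) :
  operated_lift (of_stage (tower_incl X) w) = tower_eval w.
Proof. exact/limit_lift_of_stage/tower_eval_incl. Qed.

Lemma operated_lift_gen x : operated_lift (free_operated_gen x) = f x.
Proof. by rewrite operated_lift_of_stage /= freeGroup_lift_gen. Qed.

Lemma operated_lift_morphism : operated_morphism operated_lift.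
Proof.
split=> [x y|x].
  have [n [a [b [_ [-> -> _]]]]] := limit_common x y 1.
  have -> : of_stage _ a * of_stage _ b = of_stage (tower_incl X) (a * b).
    exact: of_stageM.
  by rewrite !operated_lift_of_stage tower_evalM.
rewrite -(of_stageE x); move: (tagged _) => w.
have -> : operator (of_stage (tower_incl X) w : freeOperatedGroup X) =
    of_stage (tower_incl X) (bracket w).
  exact: free_operatorE.
by rewrite !operated_lift_of_stage /= freeGroup_lift_gen.
Qed.

Lemma operated_lift_unique (g : freeOperatedGroup X -> G) :
  operated_morphism g -> (forall x, g (free_operated_gen x) = f x) ->
  g =1 operated_lift.
Proof.
move=> [gM gP] g_gen x; rewrite -(of_stageE x); move: (tagged _).
move: (tag _) => n w; rewrite operated_lift_of_stage.
have g_stageM m (u v : tower X m) : g (of_stage (tower_incl X) (u * v)) =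
    g (of_stage (tower_incl X) u) * g (of_stage (tower_incl X) v).
  by rewrite -gM; congr g; rewrite -of_stageM.
elim: n w => [|n IHn].
  exact: (@freeGroup_lift_unique X G f
    (fun w => g (of_stage (tower_incl X) (w : tower X 0)))).
apply: (@freeGroup_lift_unique _ G (bracket_eval (@tower_eval n))
  (fun w => g (of_stage (tower_incl X) (w : tower X n.+1)))) => //.
case=> [y|w] /=; first by rewrite of_stage_gen.
by rewrite -IHn gP; congr g; rewrite -[LHS]free_operatorE.
Qed.

End OperatedLift.

Theorem theorem2p7 (X : Type) (G : operatedGroupType) (f : X -> G) :
  exists! fbar : freeOperatedGroup X -> G,
    operated_morphism fbar /\ (forall x : X, fbar (free_operated_gen x) = f x).
Proof.
exists (operated_lift f); split.
  by split; [apply: operated_lift_morphism | apply: operated_lift_gen].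
move=> g [g_morph g_gen]; apply/funext => x.
exact/esym/operated_lift_unique.
Qed.
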